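(* Let $q$ be a prime power, $n\ge 1$ and $1\le d\le n$ integers, and let $X=X(n,q)$ be the set of $n\times n$ Hermitian matrices over $\mathbb{F}_{q^2}$. Every additive $d$-code $Y$ in $X$ satisfies \[ |Y|\le q^{n(n-d+1)}. \] Moreover, if $d$ is odd, then this bound also holds for arbitrary (not necessarily additive) $d$-codes $Y$ in $X$, and equality $|Y|=q^{n(n-d+1)}$ holds if and only if $Y$ is an $(n-d+1)$-design.
   Context: For $x\in\mathbb{F}_{q^2}$ write $\overline{x}=x^q$; for a matrix $A$ over $\mathbb{F}_{q^2}$, $A^*$ denotes the conjugate transpose (entrywise conjugation followed by transposition). A square matrix $A$ is Hermitian if $A^*=A$. $X=X(n,q)$ is an abelian group under addition. A nonempty subset $Y\subseteq X$ is a $d$-code if $\operatorname{rank}(A-B)\ge d$ for all distinct $A,B\in Y$; it is additive if it is a subgroup of $(X,+)$. Fix a nontrivial character $\chi$ of $(\mathbb{F}_q,+)$ and for $A,B\in X$ put $\langle A,B\rangle=\chi(\operatorname{tr}(A^*B))$ ($\operatorname{tr}$ the matrix trace; this lies in $\mathbb{F}_q$). Let $X_k$ be the set of matrices in $X$ of rank $k$. For $i,k\in\{0,\dots,n\}$ let $Q_k(i)=\sum_{A\in X_k}\langle A,B\rangle$ for any $B\in X_i$ (this value does not depend on the choice of $B\in X_i$). The inner distribution of a nonempty $Y\subseteq X$ is $(A_0,\dots,A_n)$ with $A_i=|\{(x,y)\in Y\times Y:\operatorname{rank}(x-y)=i\}|/|Y|$, and its dual inner distribution is $(A'_0,\dots,A'_n)$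 with $A'_k=\sum_{i=0}^n Q_k(i)A_i$. $Y$ is a $t$-design if $A'_1=\dots=A'_t=0$. *)

(* Defs.v *)
From HB Require Import structures.
From mathcomp Require Import all_boot all_order all_algebra.
From mathcomp Require Import algC.
Set Implicit Arguments. Unset Strict Implicit. Unset Printing Implicit Defensive.
Import Order.TTheory GRing.Theory Num.Theory.
Local Open Scope ring_scope.

Section Herm.
Variables (F : finFieldType) (q n : nat).

Definition ctr (A : 'M[F]_n) : 'M[F]_n := (map_mx (fun x => x ^+ q) A)^T.

Definition hermX : {set 'M[F]_n} := [set A | ctr A == A].

Definition hermXk (k : nat) : {set 'M[F]_n} := [set A in hermX | \rank A == k].

Definition is_dcode (d : nat) (Y : {set 'M[F]_n}) : Prop :=
  Y != set0 /\ forall A B, A \in Y -> B \in Y -> A != B -> (d <= \rank (A - B)%R)%N.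

Definition is_additive (Y : {set 'M[F]_n}) : Prop :=
  0 \in Y /\ forall A B, A \in Y -> B \in Y -> A - B \in Y.

Variable chi : F -> algC.

(* chi is a nontrivial character of (F_q,+), F_q = {x | x^q = x} *)
Definition nontriv_char : Prop :=
  (forall x, x ^+ q = x -> chi x != 0) /\
  (forall x y, x ^+ q = x -> y ^+ q = y -> chi (x + y) = chi x * chi y) /\
  (exists x, x ^+ q = x /\ chi x != 1).

Definition inner (A B : 'M[F]_n) : algC := chi (\tr (ctr A *m B)).

Definition Qk (k i : nat) : algC :=
  let B := odflt 0 [pick B in hermXk i] in
  \sum_(A in hermXk k) inner A B.

Definition inner_dist (Y : {set 'M[F]_n}) (i : nat) : algC :=
  (#|[set xy in setX Y Y | \rank (xy.1 - xy.2)%R == i]|)%:R / (#|Y|)%:R.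

Definition dual_dist (Y : {set 'M[F]_n}) (k : nat) : algC :=
  \sum_(i < n.+1) Qk k i * inner_dist Y i.

Definition is_design (t : nat) (Y : {set 'M[F]_n}) : Prop :=
  forall k, (1 <= k <= t)%N -> dual_dist Y k = 0.

End Herm.

(* Main.v *)
(* Put [b = -q] and let [m choose l]_b be the Gaussian binomial at [b].  The key identity is
   that the Fourier transform on Hermitian matrices maps
   [A |-> [n - rk A choose l]_b] to [B |-> (-b^n)^(n-l) [n - rk B choose n-l]_b].
   A nonzero Hermitian [B] is congruent to [diag(1, B')]; summing over the first row and column
   of [A] then produces a Hermitian Gauss sum, a power of [-q], and q-Pascal reduces the
   identity to size [n-1].  The value at [B = 0] follows from the others by Fourier inversion.

   Take [l = d-1] and [j = n-d+1].  Summed over an additive d-code [Y], the identity shows that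
   [|Y|] divides [q^(nj) [n choose j]_b]; since [|Y|] is a divisor of [q^(n^2)] and the Gaussian
   binomial is 1 modulo [q], [|Y|] divides [q^(nj)].  Summed over differences of an arbitrary
   d-code with [d] odd, all coefficients [n-k choose d-1]_b are nonnegative, and the deviation of
   [|Y|] from [q^(nj)] is a positive combination of the dual distribution entries
   [A'_1, ..., A'_j]. *)

Require Import Defs.
From HB Require Import structures.
From mathcomp Require Import all_boot all_order all_algebra.
From mathcomp Require Import algC finfield mxabelem zify ring.
Set Implicit Arguments. Unset Strict Implicit. Unset Printing Implicit Defensive.
Import Order.TTheory GRing.Theory Num.Theory.
Local Open Scope ring_scope.

(** * Gaussian binomial coefficients *)

(** Integer-valued, so that the base may be [-q] while signs and divisibility both remain
    available. *)
Fixpoint gbin (b : int) (m l : nat) : int :=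
  match m, l with
  | _, 0%N => 1
  | 0%N, _.+1 => 0
  | m'.+1, l'.+1 => gbin b m' l' + b ^+ l'.+1 * gbin b m' l'.+1
  end.

Section GaussianBinomial.
Variable b : int.

Lemma gbin0 m : gbin b m 0 = 1. Proof. by case: m. Qed.

Lemma gbinS m l : gbin b m.+1 l.+1 = gbin b m l + b ^+ l.+1 * gbin b m l.+1.
Proof. by []. Qed.

Lemma gbin_small m l : (m < l)%N -> gbin b m l = 0.
Proof.
by elim: m l => [|m IH] [|l] //= lt; rewrite !IH ?mulr0 ?addr0 //; exact: ltnW.
Qed.

Lemma gbin_diag m : gbin b m m = 1.
Proof. by elim: m => //= m ->; rewrite gbin_small // mulr0 addr0. Qed.

(** This rule gives the increment in the upper index, which is what splitting off a row and column
    produces in [ft_block]. The truncated [m - l] is harmless, since [gbin b m l] vanishes for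
    [m < l]. *)
Lemma gbinS_dual m l : gbin b m.+1 l.+1 = gbin b m l.+1 + b ^+ (m - l) * gbin b m l.
Proof.
elim: m l => [|m IH] l; first by case: l => [|l] /=; ring.
rewrite gbinS; case: l => [|l].
  by rewrite {1}(IH 0%N) (gbinS m 0) !gbin0 !subn0 expr1 (exprS _ m); ring.
rewrite [in LHS](IH l) [in LHS](IH l.+1) (gbinS m l) subSS (gbinS m l.+1).
have E : b ^+ l.+2 * (b ^+ (m - l.+1) * gbin b m l.+1) =
         b ^+ (m - l) * (b ^+ l.+1 * gbin b m l.+1).
  case: (ltnP l m) => lm; last by rewrite gbin_small ?ltnS // !mulr0.
  by rewrite -(subnSK lm) !exprS; ring.
by rewrite [b ^+ l.+2 * (_ + _)]mulrDr E; ring.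
Qed.

Lemma gbin_sym m l : (l <= m)%N -> gbin b m l = gbin b m (m - l).
Proof.
elim: m l => [|m IH] [|l] //.
- by rewrite gbin0 subn0 gbin_diag.
rewrite ltnS subSS leq_eqVlt => /orP[/eqP->|lm]; first by rewrite gbin_diag subnn gbin0.
rewrite -(subnSK lm) gbinS gbinS_dual (IH l) 1?ltnW // (IH l.+1) // subnSK //.
by congr (_ + b ^+ _ * _); lia.
Qed.

(** Eliminate [gbin b m l.+1] between the two Pascal rules. *)
Lemma gbin_absorption m l : (l <= m)%N ->
  (b ^+ l.+1 - 1) * gbin b m.+1 l.+1 = (b ^+ m.+1 - 1) * gbin b m l.
Proof.
move=> lm; have E1 := gbinS m l; have E2 := gbinS_dual m l.
have -> : b ^+ m.+1 = b ^+ l.+1 * b ^+ (m - l) by rewrite -exprD; congr (_ ^+ _); lia.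
rewrite mulrBl {1}E2 E1; ring.
Qed.

(** In the Pascal rule every term but the first carries a factor [b]. *)
Lemma gbin_mod_base m l : (l <= m)%N -> (gbin b m l = 1 %[mod b])%Z.
Proof.
elim: m l => [|m IH] [|l] // lm.
rewrite gbinS exprS -mulrA addrC mulrC modzMDl; exact: IH.
Qed.

Lemma coprime_gbin m l : (l <= m)%N -> coprimez b (gbin b m l).
Proof. by move=> lm; rewrite /coprimez -gcdz_modr gbin_mod_base // gcdz_modr gcdz1. Qed.

Hypothesis b_lt : b < -1.

Lemma sgn_expB1 k : 0 < (-1) ^+ k.+1 * (b ^+ k.+1 - 1).
Proof.
have h k' : 1 <= (-1) ^+ k' * b ^+ k'.
  by rewrite -exprMn exprn_ege1 //; lia.
have h2 : 1 < (-1) ^+ k.+1 * b ^+ k.+1.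
  by rewrite !exprS; have := h k; nia.
rewrite mulrBr mulr1 subr_gt0; apply: le_lt_trans h2.
by rewrite -signr_odd; case: odd.
Qed.

(** By absorption, going from [(m, l)] to [(m.+1, l.+1)] multiplies by the quotient of
    [b ^+ m.+1 - 1] by [b ^+ l.+1 - 1], whose sign is that of [(-1) ^+ (m - l)]. *)
Lemma sgn_gbin m l : (l <= m)%N -> 0 < (-1) ^+ (l * (m - l)) * gbin b m l.
Proof.
elim: m l => [|m IH] [|l] // lm; rewrite ltnS in lm *.
have := mulr_gt0 (sgn_expB1 m) (IH l lm).
have -> : (-1) ^+ m.+1 * (b ^+ m.+1 - 1) * ((-1) ^+ (l * (m - l)) * gbin b m l) =
 ((-1) ^+ l.+1 * (b ^+ l.+1 - 1)) * ((-1) ^+ (l.+1 * (m - l)) * gbin b m.+1 l.+1).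
  have -> : (-1) ^+ m.+1 = (-1) ^+ l.+1 * (-1) ^+ (m - l) :> int.
    by rewrite -exprD; congr (_ ^+ _); lia.
  rewrite mulSn exprD; move: (gbin_absorption lm).
  move: (_ ^+ l.+1 - 1) (_ ^+ m.+1 - 1) (gbin _ _ _) (gbin _ _ _) => x y z t E.
  transitivity ((-1) ^+ l.+1 * (-1) ^+ (m - l) * (-1) ^+ (l * (m - l)) * (x * t)).
    by rewrite E; ring.
  by ring.
by rewrite pmulr_rgt0 ?sgn_expB1 // subSS.
Qed.

Lemma gbin_gt0 m l : (l <= m)%N -> ~~ odd l -> 0 < gbin b m l.
Proof.
move=> lm ol; have := sgn_gbin lm.
by rewrite -signr_odd oddM (negbTE ol) mul1r.
Qed.

End GaussianBinomial.

(** * Hermitian matrices over a quadratic extension *)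

Section HermitianMatrices.
Variables (F : finFieldType) (q : nat).
Hypothesis q_primepower : exists p m : nat, [/\ prime p, (0 < m)%N & q = (p ^ m)%N].
Hypothesis cardF : #|F| = (q ^ 2)%N.

(** * Conjugation, its fixed field, norm and trace *)

Definition cj (x : F) : F := x ^+ q.

Lemma q_gt1 : (1 < q)%N.
Proof.
by case: q_primepower => p [m [pp m0 ->]]; rewrite -{1}(exp1n m) ltn_exp2r // prime_gt1.
Qed.

Lemma cjD x y : cj (x + y) = cj x + cj y.
Proof.
case: q_primepower => p [m [pp m0 Eq]].
apply: exprDn_pchar; rewrite Eq pnatX; apply/orP; left.
rewrite pnatE //; apply: (@card_finPcharP _ p (m * 2)) => //.
by rewrite cardF Eq expnM.
Qed.

Lemma cj_is_zmod_morphism : zmod_morphism cj.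
Proof.
have cj0 : cj 0 = 0 by rewrite /cj expr0n; have := q_gt1; case: (q).
have cjN x : cj (- x) = - cj x by apply/eqP; rewrite -addr_eq0 -cjD addNr cj0.
by move=> x y; rewrite cjD cjN.
Qed.

HB.instance Definition _ := GRing.isZmodMorphism.Build F F cj cj_is_zmod_morphism.

Lemma cj_is_monoid_morphism : monoid_morphism cj.
Proof. by split=> [|x y]; rewrite /cj ?expr1n // exprMn. Qed.

HB.instance Definition _ := GRing.isMonoidMorphism.Build F F cj cj_is_monoid_morphism.

Lemma cjK : involutive cj.
Proof. by move=> x; rewrite /cj -exprM -{2}(expf_card x) cardF. Qed.

Lemma card_roots_le (p : {poly F}) : p != 0 -> (#|[set x | root p x]| <= (size p).-1)%N.
Proof.
move=> p0; rewrite cardE; have := @max_poly_roots _ p (enum [set x | root p x]) p0.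
rewrite enum_uniq => /(_ _ isT) h; suff: (size (enum [set x | root p x]) < size p)%N by lia.
by apply: h; apply/allP => x; rewrite mem_enum inE.
Qed.

Definition fixq : {set F} := [set a | cj a == a].

Lemma fixqP a : reflect (cj a = a) (a \in fixq).
Proof. by rewrite inE; apply: eqP. Qed.

Lemma norm_fixq x : x * cj x \in fixq.
Proof. by rewrite inE rmorphM /= cjK mulrC. Qed.

Lemma card_fixq_le : (#|fixq| <= q)%N.
Proof.
have sz : size ('X^q - 'X : {poly F}) = q.+1.
  by rewrite size_polyDl ?size_polyXn // size_polyN size_polyX; have := q_gt1; lia.
have := @card_roots_le ('X^q - 'X); rewrite -size_poly_eq0 sz => /(_ isT) /=.
congr (_ <= _)%N; apply: eq_card => x.
by rewrite !inE rootE !hornerE subr_eq0.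
Qed.

Lemma card_norm_fiber_le (y : F) : (#|[set x : F | (x * cj x)%R == y]| <= q.+1)%N.
Proof.
have sz : size ('X^(q.+1) - y%:P : {poly F}) = q.+2.
  by rewrite size_polyDl ?size_polyXn // size_polyN; apply: leq_ltn_trans (size_polyC_leq1 _) _.
have := @card_roots_le ('X^(q.+1) - y%:P); rewrite -size_poly_eq0 sz => /(_ isT) /=.
congr (_ <= _)%N; apply: eq_card => x.
by rewrite !inE rootE !hornerE subr_eq0 /cj -exprS.
Qed.

(* Counting [F^*] along the fibres of the norm forces both the size of the fixed field
   and the surjectivity of the norm at once. *)
Lemma norm_image_fixq : [set x * cj x | x in [set: F]] = fixq /\ #|fixq| = q.
Proof.
set N := [set _ | x in _].
have sub : N \subset fixq by apply/subsetP => _ /imsetP[x _ ->]; exact: norm_fixq.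
have N0 : 0 \in N by apply/imsetP; exists 0; rewrite ?inE // mul0r.
have cF : (q ^ 2 <= 1 + (#|N| - 1) * q.+1)%N.
  rewrite -cardF -[X in (X <= _)%N]sum1_card (partition_big (fun x => x * cj x) (mem N)) /=; last first.
    by move=> x _; apply/imsetP; exists x.
  rewrite (bigD1 0) //=. apply: leq_add.
    rewrite -(@eq_bigl _ _ _ _ _ (pred1 (0 : F))) ?big_pred1_eq // => x /=.
    by rewrite mulf_eq0 fmorph_eq0 orbb.
  have -> : (#|N| - 1)%N = #|[set y in N | y != 0]|.
    rewrite (cardsD1 0 N) N0 add1n subn1 /=; apply: eq_card => x.
    by rewrite !inE andbC.
  rewrite -sum_nat_const [X in (_ <= X)%N](eq_bigl (fun y => (y \in N) && (y != 0))); last first.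
    by move=> y; rewrite inE.
  apply: leq_sum => y _; rewrite sum1_card.
  by apply: leq_trans (card_norm_fiber_le y); apply: eq_leq; apply: eq_card => x; rewrite inE.
have le1 := subset_leq_card sub; have le2 := card_fixq_le; have q1 := q_gt1.
(* If [#|N| < q], then [cF] would give [q^2 <= 1 + (q - 2)(q + 1) = q^2 - q - 1]. *)
have qN : (q <= #|N|)%N by rewrite leqNgt; apply/negP => lt; nia.
split; last by apply/eqP; rewrite eqn_leq le2 (leq_trans qN le1).
by apply/eqP; rewrite eqEcard sub (leq_trans le2 qN).
Qed.

Lemma card_fixq : #|fixq| = q. Proof. by case: norm_image_fixq. Qed.

Lemma norm_surj a : a \in fixq -> exists x, x * cj x = a.
Proof. by case: norm_image_fixq => <- _ /imsetP[x _ ->]; exists x. Qed.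

Lemma trace_neq0 : exists y, y + cj y != 0.
Proof.
apply/existsP; apply: contraT; rewrite negb_exists => /forallP h.
have sz : size ('X^q + 'X : {poly F}) = q.+1.
  by rewrite size_polyDl ?size_polyXn // size_polyX; have := q_gt1; lia.
have := @card_roots_le ('X^q + 'X); rewrite -size_poly_eq0 sz => /(_ isT) /=.
have -> : [set x | root ('X^q + 'X) x] = [set: F].
  apply/setP => x; rewrite !inE rootE !hornerE addrC.
  by have := h x; rewrite negbK.
by rewrite cardsT cardF; have := q_gt1; nia.
Qed.

(** * Conjugate transpose and Hermitian congruence *)

Definition ct m n (A : 'M[F]_(m, n)) : 'M[F]_(n, m) := (map_mx cj A)^T.

Lemma ctE m n (A : 'M_(m, n)) i j : ct A i j = cj (A j i).
Proof. by rewrite !mxE. Qed.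

Lemma ctK m n (A : 'M_(m, n)) : ct (ct A) = A.
Proof. by apply/matrixP => i j; rewrite !ctE cjK. Qed.

Lemma ctM m n p (A : 'M_(m, n)) (B : 'M_(n, p)) : ct (A *m B) = ct B *m ct A.
Proof. by rewrite /ct map_mxM trmx_mul. Qed.

Lemma ctD m n (A B : 'M_(m, n)) : ct (A + B) = ct A + ct B.
Proof. by rewrite /ct map_mxD linearD. Qed.

Lemma ctB m n (A B : 'M_(m, n)) : ct (A - B) = ct A - ct B.
Proof. by rewrite /ct map_mxB linearB. Qed.

Lemma ctZ m n x (A : 'M_(m, n)) : ct (x *: A) = cj x *: ct A.
Proof. by rewrite /ct map_mxZ linearZ. Qed.

Lemma ct0 m n : ct (0 : 'M_(m, n)) = 0.
Proof. by rewrite /ct map_mx0 trmx0. Qed.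

Lemma ctN m n (A : 'M_(m, n)) : ct (- A) = - ct A.
Proof. by rewrite -sub0r ctB ct0 sub0r. Qed.

Lemma ct_scalar n a : ct (a%:M : 'M_n) = (cj a)%:M.
Proof. by rewrite /ct map_scalar_mx tr_scalar_mx. Qed.

Lemma ct_block m1 m2 n1 n2 (A : 'M_(m1, n1)) B C (D : 'M_(m2, n2)) :
  ct (block_mx A B C D) = block_mx (ct A) (ct C) (ct B) (ct D).
Proof. by rewrite /ct map_block_mx tr_block_mx. Qed.

Lemma ct_row_mx m n1 n2 (A : 'M_(m, n1)) (B : 'M_(m, n2)) :
  ct (row_mx A B) = col_mx (ct A) (ct B).
Proof. by rewrite /ct map_row_mx tr_row_mx. Qed.

Lemma ct_unit n (P : 'M_n) : (ct P \in unitmx) = (P \in unitmx).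
Proof. by rewrite unitmx_tr map_unitmx. Qed.

Lemma trace_ct n (A : 'M_n) : \tr (ct A) = cj (\tr A).
Proof. by rewrite mxtrace_tr trace_map_mx. Qed.

Lemma hermP n (A : 'M_n) : reflect (ct A = A) (A \in hermX F q n).
Proof. by rewrite inE; exact: eqP. Qed.

Lemma herm0 n : 0 \in hermX F q n.
Proof. by apply/hermP; rewrite ct0. Qed.

Lemma hermB n A B : A \in hermX F q n -> B \in hermX F q n -> A - B \in hermX F q n.
Proof. by move=> /hermP hA /hermP hB; apply/hermP; rewrite ctB hA hB. Qed.

Lemma herm_congr m n (P : 'M_(m, n)) A :
  A \in hermX F q n -> P *m A *m ct P \in hermX F q m.
Proof. by move=> /hermP hA; apply/hermP; rewrite !ctM ctK hA mulmxA. Qed.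

Lemma rank_congr n (P A : 'M_n) : P \in unitmx -> \rank (P *m A *m ct P) = \rank A.
Proof.
move=> uP; rewrite mxrankMfree ?row_free_unit ?ct_unit //.
by rewrite (eqmxMfull A) // row_full_unit.
Qed.

Lemma trace_herm_fixq n A B :
  A \in hermX F q n -> B \in hermX F q n -> \tr (A *m B) \in fixq.
Proof.
by move=> /hermP hA /hermP hB; apply/fixqP; rewrite -trace_ct ctM hA hB mxtrace_mulC.
Qed.

Lemma herm_entry_fixq (A : 'M_1) : A \in hermX F q 1 -> A 0 0 \in fixq.
Proof. by move=> /hermP h; apply/fixqP; rewrite -ctE h. Qed.

Lemma herm_block n (a : 'M_1) (r : 'rV_n) (c : 'cV_n) A :
  (block_mx a r c A \in hermX F q (1 + n)) =
    [&& a 0 0 \in fixq, c == ct r & A \in hermX F q n].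
Proof.
apply/hermP/and3P => [|[/fixqP ha /eqP -> /hermP hA]].
  rewrite ct_block => /eq_block_mx[ha hc hr hA]; split.
  - by apply: herm_entry_fixq; apply/hermP.
  - by rewrite -hr.
  - by apply/hermP.
rewrite ct_block ctK hA; congr block_mx.
by apply/matrixP => i j; rewrite ctE !ord1.
Qed.

(** A unit vector works if the diagonal is nonzero; otherwise polarization at a nonzero entry
    reduces to an element of nonzero trace. *)
Lemma herm_neq0_witness n (B : 'M_n) : B \in hermX F q n -> B != 0 ->
  exists v : 'rV_n, (v *m B *m ct v) 0 0 != 0.
Proof.
move=> /hermP hB B0.
case: (pickP (fun i => B i i != 0)) => [i hi|hd].
  exists (delta_mx 0 i).
  by rewrite -rowE mxE (bigD1 i) //= big1 => [|k ki]; rewrite !mxE ?eqxx ?(negbTE ki) ?andbF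
    ?rmorph0 ?mulr0 //= rmorph1 mulr1 addr0.
have /existsP[i /existsP[j hij]] : [exists i, exists j, B i j != 0].
  apply: contraT; rewrite negb_exists => /forallP h; case/negP: B0.
  apply/eqP/matrixP => i j; rewrite mxE; have := h i; apply: contraNeq => e.
  by apply/existsP; exists j.
have dB k : B k k = 0 by have := hd k; move/negbT; rewrite negbK => /eqP.
have [y hy] := trace_neq0.
(* The coefficient is chosen so that, with zero diagonal, the form takes the value [y + cj y]. *)
exists (delta_mx 0 i + (cj (y / B i j)) *: delta_mx 0 j).
have ctd k : ct (delta_mx 0 k : 'rV_n) = delta_mx k 0.
  by rewrite /ct map_delta_mx trmx_delta.
have ent k l : (delta_mx 0 k *m B *m delta_mx l 0 : 'M_1) 0 0 = B k l.
  by rewrite -rowE -colE !mxE.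
rewrite ctD ctZ cjK !ctd mulmxDl !mulmxDr !mulmxDl -!scalemxAr -!scalemxAl.
have m1 a (M : 'M_1) : (a *: M) 0 0 = a * M 0 0 by rewrite mxE.
have m2 (M N : 'M_1) : (M + N) 0 0 = M 0 0 + N 0 0 by rewrite mxE.
rewrite !(m1, m2) !ent !dB.
rewrite !mulr0 add0r addr0 -{2}hB ctE -rmorphM divfK //.
by rewrite addrC.
Qed.

(** Completion of a vector to a basis. The scalar [t] does no harm: it only multiplies the value of
    a Hermitian form by the nonzero norm of [t]. *)
Lemma unitmx_first_row n (v : 'rV[F]_n.+1) : v != 0 ->
  exists2 P : 'M_(1 + n), P \in unitmx & exists2 t, t != 0 & v = t *: row 0 P.
Proof.
move=> v0; exists (row_ebase v); first exact: row_ebase_unit.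
exists (col_ebase v 0 0).
  have := col_ebase_unit v; rewrite unitmxE (det_mx11 (col_ebase v)) unitfE.
  by [].
rewrite -{1}(mulmx_ebase v) rank_rV v0 (mx11_scalar (col_ebase v)) mul_scalar_mx -scalemxAl.
rewrite [_%:M 0 0]mxE eqxx mulr1n; congr (_ *: _); rewrite rowE; congr (_ *m _).
by apply/matrixP => i j; rewrite !mxE !ord1 eqxx /= andbT; case: j => [[|j] hj].
Qed.

(** One step of Hermitian diagonalization: an anisotropic vector becomes the first basis vector, its
    value is scaled to 1, and its row and column are cleared. *)
Lemma herm_split n (B : 'M_(1 + n)) : B \in hermX F q (1 + n) -> B != 0 ->
  exists2 P : 'M_(1 + n), P \in unitmx &
  exists2 B' : 'M_n, B' \in hermX F q n & P *m B *m ct P = block_mx 1%:M 0 0 B'.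
Proof.
move=> hB B0; have [v hv] := herm_neq0_witness hB B0.
have v0 : v != 0 by apply: contraNneq hv => ->; rewrite !mul0mx mxE.
have [P uP [t t0 Ev]] := unitmx_first_row v0.
have hC := herm_congr P hB; set C := P *m B *m ct P in hC.
pose a := ulsubmx C; pose r := ursubmx C; pose A := drsubmx C.
have EC : C = block_mx a r (ct r) A.
  have := hC; rewrite -{1}(submxK C) herm_block => /and3P[_ /eqP e _].
  by rewrite -{1}(submxK C) e.
have a0 : a 0 0 != 0.
  apply: contraNneq hv => a0.
  have -> : v *m B *m ct v = (t * cj t) *: a.
    have -> : a = row 0 P *m B *m ct (row 0 P).
      apply/matrixP => i j; rewrite !ord1 /a /C !mxE.
      rewrite lshift0; apply: eq_bigr => k _; rewrite !mxE; congr (_ * _).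
      by apply: eq_bigr => l _; rewrite !mxE.
    by rewrite Ev ctZ -!scalemxAl -scalemxAr scalerA.
  by rewrite mxE a0 mulr0.
have := hC; rewrite EC herm_block => /and3P[ha _ hA].
have cta : cj (a 0 0) = a 0 0 by apply/fixqP.
(* Surjectivity of the norm is what allows the corner to be normalized to 1, whatever its value in
   the fixed field. *)
have [x xE] := norm_surj ha.
have Ea : a = (a 0 0)%:M by apply: mx11_scalar.
move: (a 0 0) ha a0 cta xE Ea => s _ s0 cts xE Ea.
have x0 : x != 0 by apply: contraNneq s0 => x0; rewrite -xE x0 mul0r.
have cx0 : cj x != 0 by rewrite fmorph_eq0.
pose Q : 'M_(1 + n) := block_mx (x^-1)%:M 0 (- s^-1 *: ct r) 1%:M.
have uQ : Q \in unitmx.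
  by rewrite unitmxE det_lblock det1 det_scalar1 mulr1 unitfE invr_neq0.
exists (Q *m P); first by rewrite unitmx_mul uQ.
exists (A - s^-1 *: (ct r *m r)).
  apply/hermP; rewrite ctB; congr (_ - _); first exact/hermP.
  by rewrite ctZ ctM ctK fmorphV /= cts.
rewrite ctM -[LHS]mulmxA.
have -> : Q *m P *m (B *m (ct P *m ct Q)) = Q *m C *m ct Q by rewrite /C !mulmxA.
rewrite EC Ea /Q ct_block ct0 !ct_scalar (rmorph1 cj) !mulmx_block.
rewrite !mul0mx !mulmx0 !mulmx1 !mul1mx !addr0.
rewrite ctZ ctK rmorphN !(fmorphV cj) /= cts !mul_scalar_mx !mul_mx_scalar.
have -> : s *: (- s^-1 *: ct r) + ct r = 0 by rewrite scalerA mulrN divff // scaleN1r addNr.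
rewrite scaler0 mul0mx add0r; congr block_mx.
- by rewrite !scale_scalar_mx -xE; congr (_%:M); rewrite mulKf // mulVf.
- rewrite -scalemxAl mul_scalar_mx -scalerDr scalerA mulrN divff // scaleN1r addNr.
  exact: scaler0.
- by rewrite -scalemxAl scaleNr addrC.
Qed.

(** * Sums over bordered matrices and their ranks *)

Lemma sum_row_mx n (f : 'rV[F]_(1 + n) -> algC) :
  \sum_w f w = \sum_x \sum_w' f (row_mx x%:M w').
Proof.
rewrite pair_big /= (reindex (fun p : F * 'rV_n => row_mx p.1%:M p.2)) //=.
exists (fun w => (lsubmx w 0 0, rsubmx w)) => [[x w] _|w _] /=.
  by rewrite row_mxKl row_mxKr mxE eqxx.
by rewrite -mx11_scalar hsubmxK.
Qed.

Lemma sum_herm_block n (f : 'M[F]_(1 + n) -> algC) :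
  \sum_(A in hermX F q (1 + n)) f A =
  \sum_(A in hermX F q n) \sum_r \sum_(a in fixq) f (block_mx a%:M r (ct r) A).
Proof.
rewrite pair_big /= pair_big /=.
rewrite (reindex_onto (fun p : 'M_n * 'rV_n * F => block_mx p.2%:M p.1.2 (ct p.1.2) p.1.1)
  (fun A => (drsubmx A, ursubmx A, ulsubmx A 0 0))) /=; last first.
  move=> A; rewrite -{1}(submxK A) herm_block => /and3P[_ /eqP e _].
  by rewrite -mx11_scalar -e submxK.
apply: eq_bigl => -[[A r] a] /=.
by rewrite herm_block eqxx block_mxKdr block_mxKur block_mxKul mxE !eqxx /= mulr1n !andbT andbC.
Qed.

Lemma card_herm n : #|hermX F q n| = (q ^ (n ^ 2))%N.
Proof.
apply/eqP; rewrite -(eqr_nat algC); apply/eqP.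
elim: n => [|n IH].
  rewrite [#|_|](_ : _ = 1%N) //; apply/eqP/cards1P; exists 0.
  by apply/setP => A; rewrite [A]flatmx0 in_set1 eqxx herm0.
rewrite -sumr_const (sum_herm_block (fun=> 1)).
rewrite (eq_bigr (fun=> (q ^ (n.*2).+1)%:R)); last first.
  move=> A _; rewrite (eq_bigr (fun=> q%:R)); last by rewrite sumr_const card_fixq.
  rewrite sumr_const card_mx cardF mul1n -mulrnA.
  by rewrite -expnM mul2n -expnS.
rewrite sumr_const -[LHS]mulr_natr IH -natrM -expnD; congr (_ ^ _)%:R; lia.
Qed.

(** Some column [z] satisfies [A *m z = 0] and [r *m z = 1], so a column operation clears the corner
    and leaves [c] intact. *)
Lemma rank_block_notin n (a : 'M[F]_1) (r : 'rV_n) c (A : 'M_n) :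
  ~~ (r <= A)%MS -> \rank (block_mx a r c A) = \rank (block_mx 0 r c A).
Proof.
rewrite submxE => /rV0Pn[j]; set t := (_ *m _) _ _ => t0.
pose z := t^-1 *: col j (cokermx A).
have Az : A *m z = 0 by rewrite -scalemxAr colE mulmxA mulmx_coker mul0mx scaler0.
have rz : r *m z = 1%:M.
  rewrite -scalemxAr colE mulmxA -colE; apply/matrixP => i k.
  by rewrite !ord1 mxE [col _ _ _ _]mxE -/t mulVf // mxE eqxx.
pose P : 'M_(1 + n) := block_mx 1%:M 0 (- z *m a) 1%:M.
have uP : P \in unitmx by rewrite unitmxE det_lblock !det1 mulr1 unitr1.
rewrite -(mxrankMfree (block_mx a r c A) (B := P)) ?row_free_unit //.
rewrite mulmx_block !mulmx1 !mulmx0 !add0r mulNmx !mulmxN !mulmxA rz Az.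
by rewrite mul1mx mul0mx oppr0 addr0 addrN.
Qed.

(** A congruence clears the border and turns the corner into its Schur complement; exactly one value
    of [a] fails to raise the rank. *)
Lemma rank_block_in n (a : F) (w : 'rV_n) A : A \in hermX F q n ->
  \rank (block_mx a%:M (w *m A) (ct (w *m A)) A) =
  ((a != (w *m A *m ct w)%R ord0 ord0) + \rank A)%N.
Proof.
move=> /hermP hA.
pose P : 'M_(1 + n) := block_mx 1%:M (- w) 0 1%:M.
have uP : P \in unitmx by rewrite unitmxE det_ublock !det1 mulr1 unitr1.
rewrite -(rank_congr _ uP) /P ct_block !ct_scalar ct0 ctN (rmorph1 cj) !mulmx_block.
rewrite !mul0mx !mulmx0 !mul1mx !mulmx1 !add0r ctM hA.
rewrite !mulNmx !mulmxN !addrN mul0mx oppr0 addr0 rank_diag_block_mx; congr (_ + _)%N.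
rewrite rank_rV; congr (nat_of_bool _).
rewrite mulmxA; set s := _ *m _; rewrite [s in a%:M - s](mx11_scalar s) -raddfB /=.
congr negb; rewrite -[RHS]subr_eq0; apply/eqP/eqP => [/matrixP/(_ 0 0)|->]; last by rewrite raddf0.
by rewrite !mxE eqxx.
Qed.

(** * Characters and Gauss sums *)

Variable chi : F -> algC.
Hypothesis chiP : nontriv_char q chi.

Lemma fixqD x y : x \in fixq -> y \in fixq -> x + y \in fixq.
Proof. by move=> /fixqP hx /fixqP hy; apply/fixqP; rewrite rmorphD /= hx hy. Qed.

Lemma fixqN x : x \in fixq -> - x \in fixq.
Proof. by move=> /fixqP hx; apply/fixqP; rewrite rmorphN /= hx. Qed.

Lemma fixqM x y : x \in fixq -> y \in fixq -> x * y \in fixq.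
Proof. by move=> /fixqP hx /fixqP hy; apply/fixqP; rewrite rmorphM /= hx hy. Qed.

Lemma fixqV x : x \in fixq -> x^-1 \in fixq.
Proof. by move=> /fixqP hx; apply/fixqP; rewrite fmorphV /= hx. Qed.

Lemma fixq0 : 0 \in fixq.
Proof. by apply/fixqP; rewrite rmorph0. Qed.

Lemma chiD x y : x \in fixq -> y \in fixq -> chi (x + y) = chi x * chi y.
Proof. by case: chiP => _ [h _] /fixqP hx /fixqP hy; apply: h. Qed.

Lemma chi0 : chi 0 = 1.
Proof.
have h0 : chi 0 != 0 by case: chiP => h _; apply: h; apply/fixqP/fixq0.
by apply: (mulfI h0); rewrite mulr1 -chiD ?fixq0 // addr0.
Qed.

(** In characteristic [p] the values of [chi] are [p]-th roots of unity. *)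
Lemma norm_chi x : x \in fixq -> `|chi x| = 1.
Proof.
move=> hx; have hk k : x *+ k \in fixq /\ chi (x *+ k) = chi x ^+ k.
  elim: k => [|k [IH1 IH2]]; first by rewrite mulr0n fixq0 chi0 expr0.
  by rewrite mulrS exprS chiD // IH2 fixqD.
case: q_primepower => p [m [pp m0 Eq]].
have cp : p \in [pchar F].
  by apply: (@card_finPcharP _ p (m * 2)) => //; rewrite cardF Eq expnM.
have := (hk p).2; rewrite mulrn_pchar // chi0 => e.
apply/eqP; rewrite -(@pexpr_eq1 _ _ p) ?normr_ge0 ?prime_gt0 //.
by rewrite -normrX -e normr1.
Qed.

Lemma chiN x : x \in fixq -> chi (- x) = (chi x)^*.
Proof.
move=> hx; have c0 : chi x != 0 by rewrite -normr_gt0 norm_chi.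
apply: (mulfI c0); rewrite -chiD ?fixqN // subrr chi0 -normCK norm_chi //.
by rewrite expr1n.
Qed.

(** Translation by [y] multiplies the sum by [f y]. This serves both for the fixed field and for
    additive codes. *)
Lemma sum_shift_eq0 (V : finZmodType) (S : {set V}) (f : V -> algC) y :
  (forall x, (x + y \in S) = (x \in S)) ->
  (forall x, x \in S -> f (x + y) = f x * f y) -> f y != 1 -> \sum_(x in S) f x = 0.
Proof.
move=> hS hf hy; set s := \sum_(x in S) f x.
have : s * f y = s.
  rewrite /s [RHS](reindex_inj (addIr y)) mulr_suml; apply: eq_big => [x|x xS].
    by rewrite hS.
  by rewrite hf.
move/eqP; rewrite -[X in _ == X]mulr1 -subr_eq0 -mulrBr mulf_eq0 subr_eq0 (negbTE hy) orbF.
by move/eqP.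
Qed.

Lemma sum_chi_fixq s : s \in fixq -> s != 0 -> \sum_(a in fixq) chi (a * s) = 0.
Proof.
move=> hs s0; case: chiP => _ [_ [z [/fixqP hz z1]]].
have hzs : z / s \in fixq by rewrite fixqM // fixqV.
apply: (@sum_shift_eq0 _ _ _ (z / s)) => [x|x hx|]; last by rewrite divfK.
  apply/idP/idP => h; last exact: fixqD.
  by rewrite -[x](addrK (z / s)) fixqD // fixqN.
by rewrite mulrDl chiD // fixqM.
Qed.

(** Scale the argument by [c] and sum over the fixed field. Each nonzero [c] is a norm and gives the
    same sum [g], while [c = 0] gives [q^2]; by orthogonality only [x = 0] survives, with total [q].
    Hence [q^2 + (q - 1) g = q]. *)
Lemma gauss_sum1 : \sum_x chi (x * cj x) = - q%:R.
Proof.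
set g := \sum_x _.
have gc c : c \in fixq -> c != 0 -> \sum_x chi (c * (x * cj x)) = g.
  move=> /norm_surj[y <-] y0; rewrite /g.
  have {}y0 : y != 0 by apply: contraNneq y0 => ->; rewrite mul0r.
  rewrite [RHS](reindex_inj (mulfI y0)); apply: eq_bigr => x _.
  by rewrite rmorphM /=; congr chi; ring.
have e : \sum_(c in fixq) \sum_x chi (c * (x * cj x)) = q%:R.
  rewrite exchange_big /= (bigD1 0) //= [X in _ + X]big1 => [|x x0]; last first.
    by rewrite sum_chi_fixq ?norm_fixq // mulf_neq0 // fmorph_eq0.
  rewrite addr0 mul0r; under eq_bigr => c _ do rewrite mulr0 chi0.
  by rewrite sumr_const card_fixq.
move: e; rewrite (bigD1 0) ?fixq0 //= [X in _ + X](eq_bigr (fun=> g)); last first.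
  by move=> c /andP[hc c0]; rewrite gc.
under eq_bigr => x _ do rewrite mul0r chi0.
rewrite !sumr_const cardF.
have -> : #|[pred i in fixq | i != 0]| = q.-1.
  have := cardsD1 0 fixq; rewrite fixq0 card_fixq => -> /=.
  by apply: eq_card => x; rewrite !inE andbC.
have := q_gt1; case: (q) => [//|k] k1 /= e.
have k0 : k%:R != 0 :> algC by rewrite pnatr_eq0; lia.
apply: (mulfI k0); move: e; rewrite -[g *+ k]mulr_natl natrX -natr1 => e.
have -> : k%:R * g = (k%:R + 1) - (k%:R + 1) ^+ 2 by rewrite -[X in X - _]e; ring.
by ring.
Qed.

(** After diagonalization the sum factors: each of the [\rank A] unit entries contributes [-q], and
    each zero entry contributes [q^2 = (-q)^2]. *)
Lemma gauss_sum n A : A \in hermX F q n ->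
  \sum_(w : 'rV_n) chi ((w *m A *m ct w) 0 0) = (- q%:R) ^+ (2 * n - \rank A).
Proof.
elim: n A => [|n IH] A hA.
  rewrite (flatmx0 A) mxrank0 muln0 expr0 (big_pred1 0); last by move=> w; rewrite /= (thinmx0 w) eqxx.
  by rewrite !mul0mx mxE chi0.
have [->|A0] := eqVneq A 0.
  under eq_bigr => w _ do rewrite mulmx0 mul0mx mxE chi0.
  rewrite sumr_const card_mx mxrank0 subn0 cardF mul1n.
  by rewrite exprM sqrrN -!natrX.
have [P uP [A' hA' eA]] := herm_split hA A0.
rewrite -(rank_congr _ uP) eA (rank_diag_block_mx (1%:M : 'M_1)) mxrank1.
rewrite (reindex_inj (can_inj (mulmxK uP))) /=.
under eq_bigr => w _ do rewrite ctM -!mulmxA (mulmxA P) (mulmxA (_ *m A)) eA.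
rewrite (sum_row_mx (fun w => chi ((w *m (block_mx 1%:M 0 0 A' *m ct w)) 0 0))).
rewrite (eq_bigr (fun x => \sum_(w' : 'rV_n) chi (x * cj x) * chi ((w' *m A' *m ct w') 0 0))); last first.
  move=> x _; apply: eq_bigr => w _.
  rewrite ct_row_mx ct_scalar mulmxA mul_row_block mul_row_col.
  rewrite mulmx1 !mulmx0 addr0 add0r -chiD ?norm_fixq //; last first.
    by apply: herm_entry_fixq; apply: herm_congr.
  congr chi; rewrite mxE; congr (_ + _).
  by rewrite -scalar_mxM mxE eqxx.
rewrite -big_distrlr /= gauss_sum1 IH // -exprS.
by congr (_ ^+ _); have := rank_leq_row A'; lia.
Qed.

(** * Fourier transforms of rank functions *)

(** Fourier transform of a function of the corank; on Hermitian [A] the pairing [inner A B] is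
    [chi (\tr (A *m B))]. *)
Definition ft n (psi : nat -> int) (B : 'M[F]_n) : algC :=
  \sum_(A in hermX F q n) (psi (n - \rank A)%N)%:~R * chi (\tr (A *m B)).

(** Substitute [ct P *m A *m P] for [A], which preserves rank, Hermitian symmetry and, by cyclicity,
    the trace pairing. *)
Lemma ft_congr n psi (P B : 'M_n) : P \in unitmx -> ft psi (P *m B *m ct P) = ft psi B.
Proof.
move=> uP; have uQ : ct P \in unitmx by rewrite ct_unit.
rewrite /ft [RHS](reindex_inj (inj_comp (can_inj (mulmxK uP)) (can_inj (mulKmx uQ)))) /=.
apply: eq_big => [A|A hA].
  apply/idP/idP => h; first by rewrite -{2}(ctK P) herm_congr.
  have := herm_congr (invmx (ct P)) h.
  rewrite !mulmxA mulVmx // mul1mx -mulmxA.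
  suff -> : P *m ct (invmx (ct P)) = 1%:M by rewrite mulmx1.
  by rewrite -{1}(ctK P) -ctM mulVmx // ct_scalar (rmorph1 cj).
have -> : ct P *m A *m P = ct P *m A *m ct (ct P) by rewrite ctK.
rewrite rank_congr // ctK; congr (_ * chi _).
by rewrite -!mulmxA [RHS]mxtrace_mulC !mulmxA.
Qed.

Lemma card_mul_fiber n (A : 'M[F]_n) (r : 'rV_n) : (r <= A)%MS ->
  #|[set w : 'rV_n | w *m A == r]| = ((q ^ 2) ^ (n - \rank A))%N.
Proof.
move=> /submxP[w0 ->].
rewrite -cardF -(mxrank_ker A) -card_rowg -[RHS](card_imset _ (addIr w0)).
apply: eq_card => w; rewrite inE; apply/eqP/imsetP => [e|[u]].
  by exists (w - w0); rewrite ?subrK // inE; apply/sub_kermxP; rewrite mulmxBl e subrr.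
by rewrite inE => /sub_kermxP e ->; rewrite mulmxDl e add0r.
Qed.

(* The terms with [r] outside the row space of [A] cancel because the rank does not depend
   on the corner [a]; the others assemble into a Gauss sum. *)
Lemma sum_extensions n psi A : A \in hermX F q n ->
  \sum_(r : 'rV_n) \sum_(a in fixq)
    (psi (n.+1 - \rank (block_mx a%:M r (ct r) A))%N)%:~R * chi a =
  (psi (n - \rank A).+1 - psi (n - \rank A)%N)%:~R * (- q%:R) ^+ \rank A.
Proof.
move=> hA; set H := BIG_F; set d := psi _ - _; set m := (n - \rank A)%N.
have rA := rank_leq_row A.
have H0 r : ~~ (r <= A)%MS -> H r = 0.
  move=> nr; rewrite /H.
  under eq_bigr => a _ do rewrite rank_block_notin // -[in chi a](mulr1 a).
  rewrite -mulr_sumr sum_chi_fixq ?oner_eq0 ?mulr0 //.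
  by apply/fixqP; rewrite rmorph1.
have H1 w : H (w *m A) = d%:~R * chi ((w *m A *m ct w) 0 0).
  rewrite /H; set s := (_ *m ct w) 0 0.
  have sK : s \in fixq by apply: herm_entry_fixq; apply: herm_congr.
  (* Every corner except [s] yields corank [m], and [s] yields [m.+1]; the constant part is killed
     by orthogonality. *)
  rewrite (eq_bigr (fun a => (psi m)%:~R * chi (a * 1) + (if a == s then d%:~R * chi a else 0))).
    rewrite big_split /= -mulr_sumr sum_chi_fixq ?oner_eq0 //; last first.
      by apply/fixqP; rewrite rmorph1.
    by rewrite mulr0 add0r -big_mkcondr /= (bigD1 s) ?sK ?eqxx //=
      big1 ?addr0 // => a; case/andP => /andP[_ ->].
  move=> a _; rewrite rank_block_in // mulr1 -/s.
  case: eqP => [->|_] /=; last by rewrite addr0 add1n subSS.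
  by rewrite add0n subSn // -/m rmorphB /=; ring.
(* Each [r] in the row space is [w *m A] for exactly [(q ^ 2) ^ m] vectors [w], so the sum over [r]
   becomes one over all [w]. *)
have E : ((q ^ 2) ^ m)%:R * \sum_r H r = \sum_(w : 'rV_n) H (w *m A).
  rewrite [RHS](partition_big (fun w => w *m A) predT) //= mulr_sumr; apply: eq_bigr => r _.
  rewrite (eq_bigr (fun=> H r)); last by move=> w /eqP->.
  have [rin|/H0 ->] := boolP (r <= A)%MS; last by rewrite mulr0 big1.
  rewrite sumr_const -[RHS]mulr_natl; congr (_%:R * _).
  by rewrite -(card_mul_fiber rin); apply: eq_card => w; rewrite inE.
have q0 : ((q ^ 2) ^ m)%:R != 0 :> algC.
  by rewrite pnatr_eq0 -lt0n !expn_gt0 (ltnW q_gt1).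
apply: (mulfI q0); rewrite E (eq_bigr _ (fun w _ => H1 w)) -mulr_sumr gauss_sum // mulrCA.
congr (_ * _); have -> : (2 * n - \rank A = 2 * m + \rank A)%N by rewrite /m; lia.
by rewrite exprD exprM sqrrN -!natrX.
Qed.

(** The pairing splits into [chi a] and the smaller pairing, so lowering the size by one replaces
    [psi] by its first difference. *)
Lemma ft_block n psi B : B \in hermX F q n ->
  ft psi (block_mx 1%:M 0 0 B : 'M_(1 + n)) =
  \sum_(A in hermX F q n)
    (psi (n - \rank A).+1 - psi (n - \rank A)%N)%:~R * (- q%:R) ^+ \rank A * chi (\tr (A *m B)).
Proof.
move=> hB; rewrite /ft sum_herm_block; apply: eq_bigr => A hA.
rewrite -sum_extensions // mulr_suml; apply: eq_bigr => r _.
rewrite mulr_suml; apply: eq_bigr => a ha.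
rewrite mulmx_block !mulmx0 !mulmx1 !addr0 !add0r mxtrace_block chiD //.
- by rewrite mxtrace_scalar mulr1n mulrA.
- by rewrite mxtrace_scalar mulr1n.
- exact: trace_herm_fixq.
Qed.

Local Notation b := (- q%:Z).

Lemma ft_const1_eq0 n B : B \in hermX F q n -> B != 0 -> ft (fun=> 1) B = 0.
Proof.
case: n B => [|n] B hB B0; first by rewrite (flatmx0 B) eqxx in B0.
have [P uP [B' hB' eB]] := herm_split hB B0.
rewrite -(ft_congr _ _ uP) eB ft_block // big1 // => A _.
by rewrite subrr !mul0r.
Qed.

Lemma ft_const1_0 n : ft (fun=> 1) (0 : 'M_n) = (q ^ (n ^ 2))%:R.
Proof.
rewrite /ft (eq_bigr (fun=> 1)) => [|A _]; last by rewrite mulmx0 mxtrace0 chi0 mulr1.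
by rewrite sumr_const card_herm.
Qed.

(** Fourier inversion at the origin: after exchanging the sums only [A = 0] survives. *)
Lemma sum_ft n psi : \sum_(B in hermX F q n) ft psi B = (q ^ (n ^ 2))%:R * (psi n)%:~R.
Proof.
rewrite exchange_big /= (bigD1 0) ?herm0 //= [X in _ + X]big1 => [|A /andP[hA A0]].
  rewrite -mulr_sumr addr0 mxrank0 subn0 mulrC -ft_const1_0 /ft; congr (_ * _).
  by apply: eq_bigr => B _; rewrite mulmx0 mul0mx mul1r.
rewrite -mulr_sumr [X in _ * X](_ : _ = ft (fun=> 1) A); last first.
  by apply: eq_bigr => B _; rewrite mul1r mxtrace_mulC.
by rewrite ft_const1_eq0 ?mulr0.
Qed.

Definition ftC n l : algC := ((- b ^+ n) ^+ (n - l))%:~R.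

(** Transforming twice multiplies by the order of the group; the sign disappears because [n + n * n]
    is even. *)
Lemma ftC_compl n l : (l <= n)%N -> ftC n l * ftC n (n - l) = (q ^ (n ^ 2))%:R.
Proof.
move=> ln; rewrite /ftC -rmorphM /= -exprD subKn // subnK // [RHS]pmulrn.
congr (_%:~R); rewrite -[Posz (q ^ _)]natz natrX natz.
rewrite -[- b ^+ n]mulN1r exprMn -exprM [b ^+ (n * n)]exprNn mulrA -exprD.
by rewrite -signr_odd oddD oddM andbb addbb mul1r mulnn.
Qed.

Lemma ft_gbin n l B : (l <= n)%N -> B \in hermX F q n ->
  ft (fun m => gbin b m l) B = ftC n l * (gbin b (n - \rank B) (n - l))%:~R.
Proof.
elim: n l B => [|n IH] l B ln hB.
  move: ln; rewrite leqn0 => /eqP->; rewrite (flatmx0 B) mxrank0 /ftC expr0 mul1r /ft.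
  rewrite (big_pred1 0) => [|A]; last by rewrite (flatmx0 A) herm0 /= eqxx.
  by rewrite mulmx0 mxtrace0 chi0 mulr1.
have nz l' (C : 'M_n.+1) : (l' <= n.+1)%N -> C \in hermX F q n.+1 -> C != 0 ->
    ft (fun m => gbin b m l') C = ftC n.+1 l' * (gbin b (n.+1 - \rank C) (n.+1 - l'))%:~R.
  move=> l'n hC C0; have [P uP [C' hC' eC]] := herm_split hC C0.
  rewrite -(ft_congr _ _ uP) -(rank_congr _ uP) eC ft_block // rank_diag_block_mx mxrank1.
  rewrite add1n subSS; case: l' l'n => [_|l' l'n].
    rewrite big1 => [|A _]; last by rewrite !gbin0 subrr !mul0r.
    by rewrite gbin_small ?mulr0 // subn0 ltnS leq_subr.
  (* The power from the Pascal rule and the Gauss sum factor combine: [(n - \rank A - l') + \rank A]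
     no longer depends on [A]. *)
  rewrite (eq_bigr (fun A => (b ^+ (n - l'))%:~R *
    ((gbin b (n - \rank A) l')%:~R * chi (\tr (A *m C'))))) => [|A _]; last first.
    rewrite gbinS_dual addrAC subrr add0r mulrA; congr (_ * _).
    have -> : - q%:R = b%:~R :> algC by rewrite rmorphN.
    rewrite -rmorphXn -!rmorphM /=; congr (_%:~R).
    have [lm|ml] := leqP l' (n - \rank A); last by rewrite gbin_small // !mulr0 mul0r.
    rewrite mulrAC -exprD; congr (_ ^+ _ * _).
    by have := rank_leq_row A; lia.
  rewrite -mulr_sumr -[X in _ * X]/(ft (fun m => gbin b m l') C') IH // subSS mulrA.
  congr (_ * _); rewrite /ftC -rmorphM /=; congr (_%:~R).
  by rewrite subSS -exprMn mulrN -exprS.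
have [B0|B0] := eqVneq B 0; last exact: nz.
rewrite {}B0 mxrank0 subn0 {B hB}.
pose D l' := ft (fun m => gbin b m l') (0 : 'M_n.+1) - ftC n.+1 l' * (gbin b n.+1 (n.+1 - l'))%:~R.
(* Summing the known values over all [B] gives [D l + ftC n.+1 l * D (n.+1 - l) = 0]. *)
have DE l' : (l' <= n.+1)%N -> D l' = - ftC n.+1 l' * D (n.+1 - l')%N.
  move=> ln'; have := sum_ft n.+1 (fun m => gbin b m l').
  rewrite (bigD1 0) ?herm0 //=.
  rewrite (eq_bigr (fun C : 'M_n.+1 => ftC n.+1 l' * (gbin b (n.+1 - \rank C) (n.+1 - l'))%:~R));
    last first.
    by move=> C /andP[hC C0]; apply: nz.
  rewrite -mulr_sumr /D subKn // -(ftC_compl ln').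
  have -> : ft (fun m => gbin b m (n.+1 - l')) (0 : 'M_n.+1) =
     (gbin b n.+1 (n.+1 - l'))%:~R +
     \sum_(i in hermX F q n.+1 | i != 0) (gbin b (n.+1 - \rank i) (n.+1 - l'))%:~R.
    rewrite /ft (bigD1 0) ?herm0 //= mxrank0 subn0 mulmx0 mxtrace0 chi0 mulr1; congr (_ + _).
    by apply: eq_bigr => A _; rewrite mulmx0 mxtrace0 chi0 mulr1.
  by move=> e; rewrite -[X in X - _](addrK (ftC n.+1 l' *
     (\sum_(i in hermX F q n.+1 | i != 0) (gbin b (n.+1 - \rank i) (n.+1 - l'))%:~R))) e; ring.
apply/eqP; rewrite -subr_eq0 -/(D l).
have := DE l ln; rewrite (DE (n.+1 - l)%N) ?leq_subr // subKn //.
rewrite mulrA mulrNN ftC_compl // => e.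
(* Two uses of [DE] multiply [D l] by a power of [q] greater than 1, which forces [D l = 0]. *)
have : (1 - (q ^ (n.+1 ^ 2))%:R) * D l = 0 by rewrite mulrBl mul1r {1}e subrr.
move/eqP; rewrite mulf_eq0 subr_eq0 => /orP[|//].
by rewrite eq_sym pnatr_eq1 -[X in _ == X](expn0 q) eqn_exp2l ?q_gt1 //.
Qed.

(** * Codes *)

Section Codes.
Variables (n : nat) (Y : {set 'M[F]_n}).
Hypothesis Y_herm : Y \subset hermX F q n.

Lemma code_herm A : A \in Y -> A \in hermX F q n.
Proof. exact: (subsetP Y_herm). Qed.

Lemma code_diff_herm A B : A \in Y -> B \in Y -> A - B \in hermX F q n.
Proof. by move=> hA hB; rewrite hermB ?code_herm. Qed.

Lemma trace_code_fixq A x : A \in hermX F q n -> x \in Y -> \tr (A *m x) \in fixq.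
Proof. by move=> hA hx; rewrite trace_herm_fixq // code_herm. Qed.

(** * Additive codes and divisibility *)

Definition annihilates (A : 'M[F]_n) := [forall x in Y, chi (\tr (A *m x)) == 1].

Lemma additive_char_sum A : is_additive Y -> A \in hermX F q n ->
  \sum_(x in Y) chi (\tr (A *m x)) = if annihilates A then #|Y|%:R else 0.
Proof.
move=> [Y0 YB] hA; case: ifP => [/forall_inP h|/negbT].
  by rewrite (eq_bigr (fun=> 1)) ?sumr_const // => x /h/eqP.
rewrite negb_forall_in => /exists_inP[y hy y1].
have YD x z : x \in Y -> z \in Y -> x + z \in Y.
  by move=> hx hz; rewrite -[z]opprK -[- z]add0r !YB.
apply: (@sum_shift_eq0 _ _ _ y) => // x.
  by apply/idP/idP => [h|h]; [rewrite -[x](addrK y) YB | exact: YD].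
by move=> hx; rewrite mulmxDr linearD /= chiD ?trace_code_fixq.
Qed.

(** Poisson summation over the subgroup [Y] and its annihilator. *)
Lemma additive_sum_ft psi : is_additive Y ->
  \sum_(x in Y) ft psi x =
  (#|Y|%:Z * \sum_(A in hermX F q n | annihilates A) psi (n - \rank A)%N)%:~R.
Proof.
move=> addY; rewrite exchange_big /= rmorphM /= rmorph_sum /= mulr_sumr big_mkcondr /=.
apply: eq_bigr => A hA; rewrite -mulr_sumr additive_char_sum //.
by case: ifP => _; rewrite ?mulr0 // mulrC -pmulrn.
Qed.

(** Poisson summation for the constant 1: [#|Y|] times the order of the annihilator is the order of
    the whole group. *)
Lemma additive_card_dvd : is_additive Y -> (#|Y| %| q ^ (n ^ 2))%N.
Proof.
move=> addY; have := additive_sum_ft (fun=> 1) addY.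
rewrite (bigD1 0) /=; last by case: addY.
rewrite big1 => [|x /andP[hx x0]]; last by rewrite ft_const1_eq0 ?code_herm.
rewrite addr0 ft_const1_0 [LHS]pmulrn => /intr_inj e.
have : (#|Y|%:Z %| (q ^ (n ^ 2))%N%:Z)%Z by rewrite e dvdz_mulr.
by rewrite dvdzE.
Qed.

(** For rank at least [d] the corank is below [n - d + 1], so the transformed binomial vanishes and
    only [0] contributes. The set [S] will be an additive code, or the differences [x - y] for a
    fixed codeword [x]. *)
Lemma sum_ft_gbin_code d (S : {set 'M[F]_n}) :
  (1 <= d <= n)%N -> S \subset hermX F q n -> 0 \in S ->
  (forall x, x \in S -> x != 0 -> (d <= \rank x)%N) ->
  \sum_(x in S) ft (fun m => gbin b m d.-1) x =
  ftC n d.-1 * (gbin b n (n - d + 1))%:~R.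
Proof.
move=> /andP[d1 dn] hS S0 rS; have e : (n - d.-1 = n - d + 1)%N by lia.
rewrite (bigD1 0) //= ft_gbin ?herm0 //; last by lia.
rewrite mxrank0 subn0 e big1 ?addr0 // => x /andP[hx x0'].
rewrite ft_gbin ?(subsetP hS) //; last by lia.
have := rS x hx x0'; have := rank_leq_row x => h1 h2.
by rewrite gbin_small ?mulr0 //; lia.
Qed.

Lemma additive_code_bound d : (1 <= d <= n)%N -> is_additive Y -> is_dcode d Y ->
  (#|Y| <= q ^ (n * (n - d + 1)))%N.
Proof.
move=> dn addY [_ codeY]; have Y0 : 0 \in Y by case: addY.
have ndE : (n - d.-1 = n - d + 1)%N by lia.
have := additive_sum_ft (fun m => gbin b m d.-1) addY.
rewrite sum_ft_gbin_code // => [|x hx x0]; last by rewrite -[x]subr0 codeY.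
rewrite /ftC -rmorphM /= ndE => /intr_inj e.
have : (#|Y|%:Z %| (- b ^+ n) ^+ (n - d + 1) * gbin b n (n - d + 1))%Z by rewrite e dvdz_mulr.
rewrite dvdzE abszM abszX abszN abszX abszN !absz_nat -expnM.
(* The binomial is coprime to [q], hence to [#|Y|], which divides a power of [q]. *)
rewrite Gauss_dvdl; last first.
  apply: coprime_dvdl (additive_card_dvd addY) _; apply: coprimeXl.
  have := @coprime_gbin b n (n - d + 1); rewrite coprimezE abszN absz_nat; apply.
  by lia.
by apply: dvdn_leq; rewrite expn_gt0 (ltnW q_gt1).
Qed.

(** * The numbers [Qk] as character sums *)

Definition rank_sum k (B : 'M[F]_n) := \sum_(A in hermXk F q n k) chi (\tr (A *m B)).

Lemma ft_rank_sum psi B :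
  ft psi B = \sum_(k < n.+1) (psi (n - k)%N)%:~R * rank_sum k B.
Proof.
rewrite /ft (partition_big (fun A => inord (\rank A) : 'I_n.+1) predT) //=.
apply: eq_bigr => k _; rewrite mulr_sumr; apply: eq_big => A.
  rewrite [RHS]inE; congr (_ && _); rewrite -val_eqE /= inordK //.
  by rewrite ltnS rank_leq_row.
by move=> /andP[_ /eqP <-]; rewrite inordK // ltnS rank_leq_row.
Qed.

(* The values [ft (gbin b ^~ (n - k)) B] depend on [\rank B] only and are unitriangular
   in the [rank_sum k B]. *)
Lemma rank_sum_invariant k B1 B2 : B1 \in hermX F q n -> B2 \in hermX F q n ->
  \rank B1 = \rank B2 -> rank_sum k B1 = rank_sum k B2.
Proof.
move=> h1 h2 e; elim/ltn_ind: k => k IH.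
have [kn|nk] := leqP k n; last first.
  rewrite /rank_sum !big_pred0 // => A; rewrite inE andbC; case: eqP => //= rA;
  by have := rank_leq_row A; lia.
have : ft (fun m => gbin b m (n - k)) B1 = ft (fun m => gbin b m (n - k)) B2.
  by rewrite !ft_gbin ?leq_subr // e.
have kn' : (k < n.+1)%N by [].
rewrite !ft_rank_sum (bigD1 (Ordinal kn')) //= [in RHS](bigD1 (Ordinal kn')) //=.
rewrite gbin_diag !mul1r.
rewrite (eq_bigr (fun i : 'I_n.+1 => (gbin b (n - i) (n - k))%:~R * rank_sum i B2)).
  by move/addIr.
move=> i; rewrite -val_eqE /= => ik.
have [lt|ge] := ltnP i k; first by rewrite IH.
by rewrite gbin_small ?mul0r //; have := ltn_ord i; lia.
Qed.

Lemma Qk_rank k B : B \in hermX F q n -> Qk q n chi k (\rank B) = rank_sum k B.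
Proof.
(* [B] itself has the required rank, so the default matrix in [Qk] is never taken. *)
move=> hB; rewrite /Qk; case: pickP => [C|/(_ B)]; last by rewrite inE hB eqxx.
rewrite inE => /andP[hC /eqP rC] /=.
rewrite -(rank_sum_invariant k hC hB rC); apply: eq_bigr => A.
by rewrite inE => /andP[/hermP hA _]; rewrite /inner -[ctr q A]/(ct A) hA.
Qed.

(** * Arbitrary codes and the dual distribution *)

Definition char_weight (A : 'M[F]_n) := `|\sum_(x in Y) chi (\tr (A *m x))| ^+ 2.

Lemma char_weight_ge0 A : 0 <= char_weight A.
Proof. by rewrite exprn_ge0 ?normr_ge0. Qed.

Lemma char_weight0 : char_weight 0 = #|Y|%:R ^+ 2.
Proof.
rewrite /char_weight (eq_bigr (fun=> 1)) ?sumr_const ?normr_nat // => x _.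
by rewrite mul0mx mxtrace0 chi0.
Qed.

Lemma char_weightE A : A \in hermX F q n ->
  char_weight A = \sum_(x in Y) \sum_(y in Y) chi (\tr (A *m (x - y))).
Proof.
move=> hA; rewrite /char_weight normCK rmorph_sum big_distrlr /=.
apply: eq_bigr => x hx; apply: eq_bigr => y hy.
rewrite mulmxBr linearB /= chiD ?fixqN ?trace_code_fixq //.
by rewrite chiN // trace_code_fixq.
Qed.

Lemma sum_ft_pairs psi :
  \sum_(x in Y) \sum_(y in Y) ft psi (x - y) =
  \sum_(A in hermX F q n) (psi (n - \rank A)%N)%:~R * char_weight A.
Proof.
rewrite (eq_bigr (fun x => \sum_(A in hermX F q n) \sum_(y in Y)
   (psi (n - \rank A)%N)%:~R * chi (\tr (A *m (x - y))))); last first.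
  by move=> x _; rewrite exchange_big.
rewrite exchange_big /=; apply: eq_bigr => A hA; rewrite char_weightE // mulr_sumr.
by apply: eq_bigr => x _; rewrite mulr_sumr.
Qed.

(** The entries of the dual distribution are thus nonnegative, and one vanishes exactly when all
    weights of that rank do. *)
Lemma dual_dist_weight k : Y != set0 ->
  #|Y|%:R * dual_dist q chi Y k = \sum_(A in hermXk F q n k) char_weight A.
Proof.
move=> Yn0; have cY : #|Y|%:R != 0 :> algC by rewrite pnatr_eq0 cards_eq0.
have -> : \sum_(A in hermXk F q n k) char_weight A =
    \sum_(x in Y) \sum_(y in Y) Qk q n chi k (\rank (x - y)).
  rewrite (eq_bigr (fun A => \sum_(x in Y) \sum_(y in Y) chi (\tr (A *m (x - y))))); last first.
    by move=> A; rewrite inE => /andP[hA _]; rewrite char_weightE.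
  rewrite exchange_big /=; apply: eq_bigr => x hx; rewrite exchange_big /=.
  by apply: eq_bigr => y hy; rewrite Qk_rank // code_diff_herm.
rewrite pair_big /= /dual_dist mulr_sumr.
rewrite (partition_big (fun p => inord (\rank (p.1 - p.2)) : 'I_n.+1) predT) //=.
apply: eq_bigr => i _; rewrite mulrCA /inner_dist [#|Y|%:R * _]mulrC divfK // mulr_natr.
rewrite -sumr_const; apply: eq_big => p.
  rewrite !inE; congr (_ && _); rewrite -val_eqE /= inordK // ltnS; exact: rank_leq_row.
by rewrite !inE => /andP[_ /eqP->].
Qed.

Lemma odd_code_weights d : (1 <= d <= n)%N -> odd d -> is_dcode d Y ->
  \sum_(A in hermX F q n | A != 0) (gbin b (n - \rank A) d.-1)%:~R * char_weight A =
  (gbin b n d.-1)%:~R * #|Y|%:R * ((q ^ (n * (n - d + 1)))%:R - #|Y|%:R).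
Proof.
move=> dn od [_ codeY]; have := sum_ft_pairs (fun m => gbin b m d.-1).
have ndE : (n - d.-1 = n - d + 1)%N by lia.
rewrite (eq_bigr (fun=> ftC n d.-1 * (gbin b n (n - d + 1))%:~R)) => [|x hx]; last first.
  (* Although [Y] need not be a group, for each fixed [x] the differences contain 0 and otherwise
     have rank at least [d]. *)
  pose S := [set x - y | y in Y].
  have inj : {in Y &, injective (fun y => x - y)} by move=> y z _ _ /addrI/oppr_inj.
  rewrite -(big_imset (fun z => ft (fun m => gbin b m d.-1) z) inj) /= -/S.
  apply: sum_ft_gbin_code => //.
  - by apply/subsetP => _ /imsetP[y hy ->]; rewrite code_diff_herm.
  - by apply/imsetP; exists x; rewrite ?subrr.
  - by move=> _ /imsetP[y hy ->]; rewrite subr_eq0 => xy; rewrite codeY.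
rewrite sumr_const (bigD1 0) ?herm0 //= mxrank0 subn0 char_weight0 -ndE -gbin_sym; last by lia.
(* For [d] odd, [n - d + 1] has the parity of [n], so the sign exponent [n.+1 * (n - d + 1)] is
   even. *)
have -> : ftC n d.-1 = (q ^ (n * (n - d + 1)))%:R.
  rewrite /ftC ndE [RHS]pmulrn; congr (_%:~R); rewrite -[Posz (q ^ _)]natz natrX natz.
  rewrite -[- b ^+ n]mulN1r [b ^+ n]exprNn mulrA -exprS exprMn -!exprM -signr_odd oddM.
  suff -> : odd n.+1 && odd (n - d + 1) = false by rewrite mul1r.
  by rewrite oddD oddB ?(andP dn).2 // od /=; case: odd.
rewrite -[LHS]mulr_natr; set R := \sum_(_ in _ | _) _; rewrite ndE => e.
apply: (addrI ((gbin b n d.-1)%:~R * #|Y|%:R ^+ 2)); rewrite -e; ring.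
Qed.

(** Since [d.-1] is even, the coefficients in [odd_code_weights] are positive for rank at most
    [n - d + 1] and zero beyond. So the deficit is nonnegative, and it is zero exactly when the
    weights of ranks 1 to [n - d + 1] vanish. *)
Lemma odd_code_bound d : (1 <= d <= n)%N -> odd d -> is_dcode d Y ->
  (#|Y| <= q ^ (n * (n - d + 1)))%N /\
  (#|Y| = (q ^ (n * (n - d + 1)))%N <-> is_design q chi (n - d + 1) Y).
Proof.
move=> dn od codeY; have := odd_code_weights dn od codeY; case: codeY => Yn0 _.
set N := (q ^ _)%N; set W := \sum_(_ in _ | _) _ => WE.
have b_lt : b < -1 by have := q_gt1; lia.
have od' : ~~ odd d.-1 by case: (d) dn od => [//|d'] _ /=.
have Y0 : 0 < #|Y|%:R :> algC by rewrite ltr0n card_gt0.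
have g0 : 0 < (gbin b n d.-1)%:~R :> algC by rewrite ltr0z gbin_gt0 //; lia.
have term0 (A : 'M_n) : 0 <= (gbin b (n - \rank A) d.-1)%:~R * char_weight A.
  rewrite mulr_ge0 ?char_weight_ge0 // ler0z.
  have [le|lt] := leqP d.-1 (n - \rank A); first by rewrite ltW ?gbin_gt0.
  by rewrite gbin_small.
have W0 : 0 <= W by apply: sumr_ge0 => A _.
split.
  by move: W0; rewrite WE pmulr_rge0 ?mulr_gt0 // subr_ge0 ler_nat.
have eqW : (#|Y| = N) <-> W = 0.
  rewrite WE; split=> [->|/eqP]; first by rewrite subrr mulr0.
  rewrite !mulf_eq0 subr_eq0 (gt_eqF g0) (gt_eqF Y0) /= eqr_nat.
  by move/eqP.
rewrite eqW; split=> [/(psumr_eq0P (fun A _ => term0 A)) W_eq0 k kj|des].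
  apply/eqP; rewrite -(inj_eq (mulfI (lt0r_neq0 Y0))) mulr0 dual_dist_weight //.
  rewrite big1 // => A; rewrite inE => /andP[hA /eqP rA].
  have A0 : A != 0 by rewrite -mxrank_eq0 rA; lia.
  have /eqP : (gbin b (n - \rank A) d.-1)%:~R * char_weight A = 0 by rewrite W_eq0 ?hA.
  rewrite mulf_eq0 intr_eq0 (gt_eqF (gbin_gt0 b_lt _ _)) ?rA //=; last by lia.
  by move/eqP.
apply: big1 => A /andP[hA A0].
have [le|lt] := leqP (\rank A) (n - d + 1); last first.
  by rewrite gbin_small ?mul0r //; have := rank_leq_row A; lia.
have rA : (1 <= \rank A <= n - d + 1)%N by rewrite le lt0n mxrank_eq0 A0.
have := dual_dist_weight (\rank A) Yn0; rewrite des // mulr0 => /esym.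
move/(psumr_eq0P (fun B _ => char_weight_ge0 B)) => h.
by rewrite h ?mulr0 // inE hA eqxx.
Qed.

End Codes.

End HermitianMatrices.

Theorem theorem3p1 (F : finFieldType) (q n d : nat) (chi : F -> algC) :
  (exists p m : nat, [/\ prime p, (0 < m)%N & q = (p ^ m)%N]) ->
  #|F| = (q ^ 2)%N ->
  (1 <= n)%N -> (1 <= d <= n)%N ->
  nontriv_char q chi ->
  (forall Y : {set 'M[F]_n}, Y \subset hermX F q n ->
     is_additive Y -> is_dcode d Y -> (#|Y| <= q ^ (n * (n - d + 1)))%N) /\
  (odd d ->
   forall Y : {set 'M[F]_n}, Y \subset hermX F q n -> is_dcode d Y ->
     (#|Y| <= q ^ (n * (n - d + 1)))%N /\
     (#|Y| = (q ^ (n * (n - d + 1)))%N <-> is_design q chi (n - d + 1) Y)).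
Proof.
move=> qpp cF _ dn chiP; split=> [Y hY addY codeY|od Y hY codeY].
  exact: (additive_code_bound qpp cF chiP hY dn addY codeY).
exact: (odd_code_bound qpp cF chiP hY dn od codeY).
Qed.
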